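(* Let $z^*=(L^*,\xi^* )$ be a global minimizer of problem (P). Let there be a constant $c>0$ and a direction $u\in\mathbb R^2$ with $\|u\|=1$ such that $u^T\xi^*_\tau(\tau)\ge c$ for almost all $\tau\in]0,1[$. Then for any $z=(L,\xi)\in Z$ with $\|z-z^*\|_{Z^\infty}\le R$ and $R<c$, $$\inf_{0\ne\lambda\in L^2(]0,1[)}\ \sup_{\delta z\in\delta Z}\ \frac{\int_0^1\lambda\,(2\xi_\tau^T\delta\xi_\tau-2L\,\delta L)\,d\tau}{\|\lambda\|_{L^2}\,\|\delta z\|_{Z^2}}\ \ge\ \kappa(R):=(c-R)\Big[\tfrac38+2\Big(\tfrac{\bar v+\bar c_0}{\bar v-\bar c_0}+\tfrac{R}{\tilde L}\Big)^2\Big]^{-1/2}>0.$$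
   Context: Fix an airspeed $\bar v>0$, points $x_O\neq x_D\in\mathbb R^2$, $\tilde L:=\|x_D-x_O\|$, and a wind field $w\in C^3(\mathbb R^2,\mathbb R^2)$ with $\|w(x)\|<\bar v$. Let $\Omega\subset\mathbb R^2$ be an ellipse with foci $x_O,x_D$ containing every globally optimal trajectory, and let $\bar c_0<\bar v$ with $\|w(x)\|\le\bar c_0$ for all $x\in\Omega$. Let $f(x,p)=\frac{-p^Tw(x)+\sqrt{(p^Tw(x))^2+(\bar v^2-w(x)^Tw(x))p^Tp}}{\bar v^2-w(x)^Tw(x)}$, $X=\{\xi\in W^{1,\infty}(]0,1[,\mathbb R^2):\xi(0)=x_O,\xi(1)=x_D\}$, $\delta X=W_0^{1,\infty}(]0,1[,\mathbb R^2)$, $\xi_\tau$ the derivative, $T(\xi)=\int_0^1f(\xi,\xi_\tau)d\tau$. Problem (P): minimize $T(\xi)$ over $\xi\in X$, $L\in\mathbb R$ subject to $\|\xi_\tau(\tau)\|^2=L^2$ for a.a. $\tau$. $Z=\mathbb R\times X$, $\delta Z=\mathbb R\times\delta X$, $\delta z=(\delta L,\delta\xi)$. Norms ($\|\cdot\|$ Euclidean pointwise): $\|z\|_{Z^\infty}=|L|+\|\xi\|_{L^\infty}+\|\xi_\tau\|_{L^\infty}$, $\|z\|_{Z^2}=|L|+\|\xi\|_{L^2}+\|\xi_\tau\|_{L^2}$. *)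

(* Defs.v *)
From HB Require Import structures.
From mathcomp Require Import all_boot all_order all_algebra.
From mathcomp Require Import all_classical all_reals all_analysis.
Set Implicit Arguments. Unset Strict Implicit. Unset Printing Implicit Defensive.
Import Order.TTheory GRing.Theory Num.Theory.
Import numFieldNormedType.Exports.
Local Open Scope classical_set_scope.
Local Open Scope ring_scope.

Section Defs.
Variable R : realType.
Local Notation mu := (@lebesgue_measure R).
Local Notation V2 := (R * R)%type.

Definition dot (p q : V2) : R := p.1 * q.1 + p.2 * q.2.
Definition enorm (p : V2) : R := Num.sqrt (dot p p).
Definition vsub (p q : V2) : V2 := (p.1 - q.1, p.2 - q.2).

Definition e_ (b : bool) : V2 := if b then (1, 0) else (0, 1).
Definition pd (b : bool) (g : V2 -> V2) : V2 -> V2 := fun x => 'D_(e_ b) g x.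

Definition C3 (g : V2 -> V2) : Prop :=
  forall a b c : bool,
    (forall x, derivable g x (e_ a)) /\
    (forall x, derivable (pd a g) x (e_ b)) /\
    (forall x, derivable (pd b (pd a g)) x (e_ c)) /\
    continuous g /\ continuous (pd a g) /\ continuous (pd b (pd a g)) /\
    continuous (pd c (pd b (pd a g))).

Definition I01 : set R := `[0, 1].

Definition Linf_fun (g : R -> V2) : Prop :=
  measurable_fun I01 (fun t => (g t).1) /\ measurable_fun I01 (fun t => (g t).2) /\
  exists M : R, {ae mu, forall t, I01 t -> enorm (g t) <= M}.

Definition Linf_norm (g : R -> V2) : R :=
  inf [set M : R | 0 <= M /\ {ae mu, forall t, I01 t -> enorm (g t) <= M}].

Definition L2_norm (g : R -> V2) : R :=
  Num.sqrt (\int[mu]_(t in I01) (enorm (g t) ^+ 2)).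
Definition L2_norm1 (g : R -> R) : R :=
  Num.sqrt (\int[mu]_(t in I01) (g t ^+ 2)).

Definition L2_fun (g : R -> R) : Prop :=
  measurable_fun I01 g /\ mu.-integrable I01 (fun t => (g t ^+ 2)%:E).

(* xi is (the continuous representative of) an element of W^{1,infty}(]0,1[,R^2)
   with weak derivative dxi *)
Definition W1inf (xi dxi : R -> V2) : Prop :=
  Linf_fun dxi /\
  forall t, 0 <= t <= 1 ->
    xi t = ((xi 0).1 + \int[mu]_(s in `[0, t]) (dxi s).1,
            (xi 0).2 + \int[mu]_(s in `[0, t]) (dxi s).2).

Definition inX (xO xD : V2) (xi dxi : R -> V2) : Prop :=
  W1inf xi dxi /\ xi 0 = xO /\ xi 1 = xD.

Definition indX (xi dxi : R -> V2) : Prop :=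
  W1inf xi dxi /\ xi 0 = (0, 0) /\ xi 1 = (0, 0).

Definition ftime (vbar : R) (w : V2 -> V2) (x p : V2) : R :=
  let a := vbar ^+ 2 - dot (w x) (w x) in
  (- dot p (w x) + Num.sqrt (dot p (w x) ^+ 2 + a * dot p p)) / a.

Definition Ttime (vbar : R) (w : V2 -> V2) (xi dxi : R -> V2) : R :=
  \int[mu]_(t in I01) ftime vbar w (xi t) (dxi t).

Definition feasibleP (xO xD : V2) (L : R) (xi dxi : R -> V2) : Prop :=
  inX xO xD xi dxi /\ {ae mu, forall t, I01 t -> dot (dxi t) (dxi t) = L ^+ 2}.

Definition global_minP (vbar : R) (w : V2 -> V2) (xO xD : V2)
    (L : R) (xi dxi : R -> V2) : Prop :=
  feasibleP xO xD L xi dxi /\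
  forall L' xi' dxi', feasibleP xO xD L' xi' dxi' ->
    Ttime vbar w xi dxi <= Ttime vbar w xi' dxi'.

Definition ellipse_foci (xO xD : V2) (Om : set V2) : Prop :=
  exists a : R, enorm (vsub xD xO) < 2 * a /\
    Om = [set x | enorm (vsub x xO) + enorm (vsub x xD) <= 2 * a].

Definition Zinf_dist (L : R) (xi dxi : R -> V2) (L' : R) (xi' dxi' : R -> V2) : R :=
  `|L - L'| + Linf_norm (fun t => vsub (xi t) (xi' t))
            + Linf_norm (fun t => vsub (dxi t) (dxi' t)).

Definition Z2_norm (dL : R) (dxi ddxi : R -> V2) : R :=
  `|dL| + L2_norm dxi + L2_norm ddxi.

Definition infsup_ratio (L : R) (dxi : R -> V2) (lam : R -> R)
    (dL : R) (delxi ddelxi : R -> V2) : R :=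
  (\int[mu]_(t in I01) (lam t * (2 * dot (dxi t) (ddelxi t) - 2 * L * dL)))
  / (L2_norm1 lam * Z2_norm dL delxi ddelxi).

Definition sup_dz (L : R) (dxi : R -> V2) (lam : R -> R) : \bar R :=
  ereal_sup [set r : \bar R | exists dL delxi ddelxi,
     indX delxi ddelxi /\ Z2_norm dL delxi ddelxi != 0 /\
     r = (infsup_ratio L dxi lam dL delxi ddelxi)%:E].

Definition infsup (L : R) (dxi : R -> V2) : \bar R :=
  ereal_inf [set s : \bar R | exists lam, L2_fun lam /\ L2_norm1 lam != 0 /\
     s = sup_dz L dxi lam].

Definition kappa (vbar c0bar c Ltil Rr : R) : R :=
  (c - Rr) * (Num.sqrt (3 / 8 + 2 * ((vbar + c0bar) / (vbar - c0bar) + Rr / Ltil) ^+ 2))^-1.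

End Defs.

(* Main.v *)
Require Import Defs.
From HB Require Import structures.
From mathcomp Require Import all_boot all_order all_algebra.
From mathcomp Require Import all_classical all_reals all_analysis.
From mathcomp Require Import measurable_realfun.
From mathcomp Require Import ring lra.
Import Order.TTheory GRing.Theory Num.Theory.
Import numFieldNormedType.Exports.
Local Open Scope classical_set_scope.
Local Open Scope ring_scope.

(** Since [Z2_norm] is a sum, the supremum over [delta z] is at least what is
    reached by varying [L] alone or [xi] alone. Let [m] and [N] be the mean and
    the L2 norm of [lam], and write [kappa = (c - R) s]; then [s < 13/20]
    because [(vbar + c0bar) / (vbar - c0bar) >= 1]. Varying [L] gives
    [2 |L| |m| / N], so one may assume [|m| < kappa N / (2 |L|)].

    Vary now [xi] by the primitive of [g u], where [g] is the centered
    truncation of [lam]: it vanishes at both ends, and its L2 norm is at most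
    half that of [g]. The weight [a = u . xi'] lies in
    [[c - r, |L*| + r]] where [r] is the L^infty distance of the derivatives, and,
    as [g] has mean zero,
      [int lam a g = int a g^2 + int a g (lam - m - g) + m int (a - b) g]
    for every constant [b]. With [b] the midpoint of that interval,
    [|a - b| <= |L*| - c + r <= |L|], so the last term is at most
    [kappa N |g| / 2], which the first one dominates. *)

(** * Square-integrable functions on the unit interval *)

Local Notation mu := (@lebesgue_measure _).
Local Notation I := (@I01 _).
Local Notation integrable01 f := (mu.-integrable I (EFin \o f)).

Lemma measurable_I01 {R : realType} : measurable (@I01 R : set (measurableTypeR R)).
Proof. exact: measurable_itv. Qed.

Lemma lebesgue_measure_I01 {R : realType} : mu (@I01 R) = 1%E.
Proof. by rewrite /I01 lebesgue_measure_itv/= lte_fin ltr01 oppr0 adde0. Qed.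

#[local] Hint Resolve measurable_I01 : core.

Lemma Rintegral_cst01 {R : realType} (r : R) : \int[mu]_(t in I) r = r.
Proof.
rewrite (Rintegral_cst _ measurable_I01).
rewrite -[RHS]mulr1; congr (_ * _); exact: (congr1 fine lebesgue_measure_I01).
Qed.

Lemma bounded_integrable01 {R : realType} (f : R -> R) (M : R) :
  measurable_fun I f -> (forall t, I t -> `|f t| <= M) -> integrable01 f.
Proof.
move=> mf fM; apply: measurable_bounded_integrable => //.
  exact: (eq_ind_r (fun x => (x < +oo)%E) (ltry 1) lebesgue_measure_I01).
exists M; split; first exact: num_real.
by move=> x Mx t It /=; rewrite (le_trans (fM _ It))// ltW.
Qed.

Lemma L2_fun_bounded {R : realType} {f : R -> R} (M : R) :
  measurable_fun I f -> (forall t, I t -> `|f t| <= M) -> L2_fun f.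
Proof.
move=> mf fM; split=> //.
apply: (@bounded_integrable01 _ (fun t => f t ^+ 2) (M ^+ 2)).
  exact: measurable_funX.
by move=> t It; rewrite normrX lerXn2r ?nnegrE// ?fM// (le_trans _ (fM _ It)).
Qed.

Lemma L2_fun_cst {R : realType} (k : R) : L2_fun (fun=> k).
Proof. by apply: (@L2_fun_bounded _ _ `|k|) => //; exact: measurable_cst. Qed.

(** The product is dominated pointwise by [f ^+ 2 + g ^+ 2]. *)
Lemma integrable01M {R : realType} {f g : R -> R} :
  L2_fun f -> L2_fun g -> integrable01 (fun t => f t * g t).
Proof.
move=> [mf if2] [mg ig2].
have ifg := integrableD measurable_I01 if2 ig2.
apply: (le_integrable measurable_I01 _ _ ifg).
  by apply/measurable_EFinP; exact: measurable_funM.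
move=> t _ /=; rewrite lee_fin normrM [leRHS]ger0_norm ?addr_ge0 ?sqr_ge0//.
rewrite -(real_normK (num_real (f t))) -(real_normK (num_real (g t))).
have := sqr_ge0 (`|f t| - `|g t|); have := normr_ge0 (f t).
have := normr_ge0 (g t); nra.
Qed.

Lemma L2_integrable {R : realType} {f : R -> R} : L2_fun f -> integrable01 f.
Proof.
move=> Lf; have := integrable01M Lf (L2_fun_cst 1).
by apply: eq_integrable => // t _ /=; rewrite mulr1.
Qed.

Lemma L2_funM {R : realType} {f g : R -> R} (M : R) :
  L2_fun f -> measurable_fun I g -> (forall t, I t -> `|g t| <= M) ->
  L2_fun (fun t => f t * g t).
Proof.
move=> [mf if2] mg gM; split; first exact: measurable_funM.
have := integrableZl measurable_I01 (M ^+ 2) if2.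
apply: (le_integrable measurable_I01).
  by apply/measurable_EFinP; apply: measurable_funX; exact: measurable_funM.
move=> t It /=; rewrite lee_fin ger0_norm ?sqr_ge0//.
apply: le_trans (ler_norm _); rewrite exprMn mulrC.
rewrite ler_wpM2r ?sqr_ge0// -(real_normK (num_real (g t))).
by rewrite lerXn2r ?nnegrE ?gM// (le_trans _ (gM _ It)).
Qed.

Lemma L2_funZ {R : realType} {f : R -> R} (k : R) :
  L2_fun f -> L2_fun (fun t => k * f t).
Proof.
move=> Lf; have := @L2_funM R f (fun=> k) `|k| Lf.
rewrite (_ : (fun t => f t * k) = (fun t => k * f t)); last first.
  by apply/funext => t; rewrite mulrC.
by apply => //; exact: measurable_cst.
Qed.

Lemma L2_funD {R : realType} {f g : R -> R} :
  L2_fun f -> L2_fun g -> L2_fun (fun t => f t + g t).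
Proof.
move=> Lf Lg; split; first exact: measurable_funD Lf.1 Lg.1.
have ifg := integrableZl measurable_I01 2 (integrable01M Lf Lg).
have := integrableD measurable_I01 (integrableD measurable_I01 Lf.2 ifg) Lg.2.
apply: eq_integrable => // t _ /=; rewrite -EFinM -!EFinD; congr EFin; ring.
Qed.

Lemma L2_funB {R : realType} {f g : R -> R} :
  L2_fun f -> L2_fun g -> L2_fun (fun t => f t - g t).
Proof.
move=> Lf Lg; have := L2_funD Lf (L2_funZ (-1) Lg).
rewrite (_ : (fun t => f t + -1 * g t) = (fun t => f t - g t))//.
by apply/funext => t; rewrite mulN1r.
Qed.

Lemma L2_norm1_ge0 {R : realType} (f : R -> R) : 0 <= L2_norm1 f.
Proof. exact: sqrtr_ge0. Qed.

Lemma sqr_L2_norm1 {R : realType} (f : R -> R) :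
  L2_norm1 f ^+ 2 = \int[mu]_(t in I) (f t ^+ 2).
Proof. by rewrite sqr_sqrtr// Rintegral_ge0// => t _; exact: sqr_ge0. Qed.

Lemma sqr_L2_norm1D {R : realType} {f g : R -> R} : L2_fun f -> L2_fun g ->
  L2_norm1 (fun t => f t + g t) ^+ 2 =
  L2_norm1 f ^+ 2 + 2 * (\int[mu]_(t in I) (f t * g t)) + L2_norm1 g ^+ 2.
Proof.
move=> Lf Lg; rewrite !sqr_L2_norm1.
have ifg := integrable01M Lf Lg; have [_ if2] := Lf; have [_ ig2] := Lg.
have i2fg : integrable01 (fun t => 2 * (f t * g t)).
  exact: (integrableZl measurable_I01 2 ifg).
rewrite -(RintegralZl _ measurable_I01 ifg)//.
rewrite -(RintegralD measurable_I01 if2 i2fg) -RintegralD//.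
  by apply: eq_Rintegral => t _; ring.
exact: (integrableD measurable_I01 if2 i2fg).
Qed.

Lemma sqr_L2_norm1Z {R : realType} (f : R -> R) (k : R) : L2_fun f ->
  L2_norm1 (fun t => k * f t) ^+ 2 = k ^+ 2 * L2_norm1 f ^+ 2.
Proof.
move=> Lf; rewrite !sqr_L2_norm1 -(RintegralZl _ measurable_I01 Lf.2).
by apply: eq_Rintegral => t _; rewrite exprMn.
Qed.

(** The squared norm of [f + k g] is a quadratic polynomial in [k] that is nowhere negative;
    evaluating it at one well-chosen [k] gives the bound. *)
Lemma Cauchy_Schwarz01 {R : realType} {f g : R -> R} : L2_fun f -> L2_fun g ->
  `|\int[mu]_(t in I) (f t * g t)| <= L2_norm1 f * L2_norm1 g.
Proof.
move=> Lf Lg; set B := \int[mu]_(t in I) _.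
have quad k : 0 <= L2_norm1 f ^+ 2 + 2 * (k * B) + k ^+ 2 * L2_norm1 g ^+ 2.
  rewrite -sqr_L2_norm1Z// /B -(RintegralZl _ measurable_I01 (integrable01M Lf Lg)).
  under eq_Rintegral do rewrite mulrCA.
  by rewrite -sqr_L2_norm1D ?sqr_ge0//; exact: L2_funZ.
rewrite -ler_sqr ?nnegrE ?mulr_ge0 ?L2_norm1_ge0// real_normK ?num_real//.
have [g0|g0] := eqVneq (L2_norm1 g) 0.
  have [->|B0] := eqVneq B 0; first by rewrite expr0n/= sqr_ge0.
  (* With no quadratic term the polynomial is affine in [k]; if [B] were nonzero, this [k] would
     give it the value [-1]. *)
  have := quad (- (L2_norm1 f ^+ 2 + 1) / (2 * B)); rewrite g0 expr0n/= mulr0.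
  rewrite (_ : 2 * _ = - (L2_norm1 f ^+ 2 + 1)); last by field.
  lra.
(* The minimizer of the quadratic. *)
have := quad (- B / L2_norm1 g ^+ 2).
have g2 : 0 < L2_norm1 g ^+ 2 by rewrite exprn_even_gt0.
rewrite (_ : _ + _ + _ = L2_norm1 f ^+ 2 - B ^+ 2 / L2_norm1 g ^+ 2); last by field.
by rewrite subr_ge0 ler_pdivrMr// exprMn.
Qed.

Lemma L2_norm1D {R : realType} {f g : R -> R} : L2_fun f -> L2_fun g ->
  L2_norm1 (fun t => f t + g t) <= L2_norm1 f + L2_norm1 g.
Proof.
move=> Lf Lg.
rewrite -ler_sqr ?nnegrE ?addr_ge0 ?L2_norm1_ge0// sqr_L2_norm1D//.
have := Cauchy_Schwarz01 Lf Lg; have := ler_norm (\int[mu]_(t in I) (f t * g t)).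
nra.
Qed.

(** * Centering and truncation *)

Definition centered {R : realType} (f : R -> R) : R -> R :=
  fun t => f t - \int[mu]_(s in I) f s.

Lemma L2_fun_centered {R : realType} {f : R -> R} :
  L2_fun f -> L2_fun (centered f).
Proof. by move=> Lf; apply: L2_funB => //; exact: L2_fun_cst. Qed.

Lemma Rintegral_centered {R : realType} {f : R -> R} : L2_fun f ->
  \int[mu]_(t in I) centered f t = 0.
Proof.
move=> Lf; have ic := L2_integrable (L2_fun_cst (\int[mu]_(t in I) f t)).
by rewrite (RintegralB measurable_I01 (L2_integrable Lf) ic) Rintegral_cst01 subrr.
Qed.

(** Pythagoras: [centered] is the orthogonal projection onto the complement of the constants, and
    the mean is the component along them. *)
Lemma sqr_L2_norm1_centered {R : realType} (f : R -> R) : L2_fun f ->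
  L2_norm1 (centered f) ^+ 2 = L2_norm1 f ^+ 2 - (\int[mu]_(t in I) f t) ^+ 2.
Proof.
move=> Lf; set m := \int[mu]_(t in I) f t.
rewrite /centered -/m (sqr_L2_norm1D Lf (L2_fun_cst (- m))).
rewrite (RintegralZr _ measurable_I01 (L2_integrable Lf)) -/m.
rewrite [L2_norm1 (fun=> - m) ^+ 2]sqr_L2_norm1 Rintegral_cst01; ring.
Qed.

Lemma L2_norm1_centered_le {R : realType} (f : R -> R) : L2_fun f ->
  L2_norm1 (centered f) <= L2_norm1 f.
Proof.
move=> Lf; rewrite -ler_sqr ?nnegrE ?L2_norm1_ge0// sqr_L2_norm1_centered//.
by rewrite gerBl sqr_ge0.
Qed.

(** Serves twice: to truncate the multiplier to a bounded function, and to turn bounds on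
    [dot u (dxi t)] that hold almost everywhere into bounds at every point. *)
Definition clamp {R : realType} (a b x : R) : R := Num.max a (Num.min b x).

Lemma clamp_itv {R : realType} (a b x : R) : a <= b -> a <= clamp a b x <= b.
Proof. by move=> ab; rewrite /clamp le_max lexx/= ge_max ab ge_min lexx. Qed.

Lemma clamp_id {R : realType} (a b x : R) : a <= x <= b -> clamp a b x = x.
Proof. by case/andP=> ax xb; rewrite /clamp (min_r xb) (max_r ax). Qed.

Lemma clamp_dist {R : realType} (k x : R) : 0 <= k ->
  `|x - clamp (- k) k x| <= `|x|.
Proof.
move=> k0; rewrite ler_norml /clamp.
have := ler_norm x; have := ler_norm (- x); rewrite normrN.
by have [?|?] := leP k x; [have [?|?] := leP (- k) k|have [?|?] := leP (- k) x]; lra.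
Qed.

Lemma measurable_clamp {R : realType} (a b : R) (f : R -> R) :
  measurable_fun I f -> measurable_fun I (fun t => clamp a b (f t)).
Proof.
move=> mf; apply: measurable_maxr; first exact: measurable_cst.
by apply: measurable_minr => //; exact: measurable_cst.
Qed.

(** The derivative of an admissible variation must be essentially bounded, whereas the multiplier is
    only in L2. The truncations at height [n] converge in L2 by dominated convergence, with [f ^+ 2]
    as dominating function. *)
Lemma L2_truncation {R : realType} {f : R -> R} (e : R) : L2_fun f -> 0 < e ->
  exists h : R -> R, [/\ measurable_fun I h,
    exists M, forall t, `|h t| <= M & L2_norm1 (fun t => f t - h t) <= e].
Proof.
move=> [mf if2] e0.
pose h (n : nat) t := clamp (- n%:R) n%:R (f t).
have mh n : measurable_fun I (h n) by exact: measurable_clamp.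
have hn n t : `|h n t| <= n%:R by rewrite ler_norml clamp_itv// ge0_cp.
have fh n t : `|f t - h n t| <= `|f t| by exact: clamp_dist.
have mfh n : measurable_fun I (fun t => ((f t - h n t) ^+ 2)%:E).
  apply/measurable_EFinP; apply: measurable_funX; exact: measurable_funB.
have fh0 : {ae mu, forall t, I t -> ((f t - h n t) ^+ 2)%:E @[n --> \oo] --> 0%E}.
  apply: aeW => t _; apply: cvg_near_cst.
  (* At a fixed [t] the truncation is exact as soon as [n] reaches [|f t|]. *)
  near=> n; rewrite /h clamp_id ?subrr ?expr0n// -ler_norml.
  by near: n; exact: nbhs_infty_ger.
have fhf : {ae mu, forall t n, I t -> (`|((f t - h n t) ^+ 2)%:E| <= (f t ^+ 2)%:E)%E}.
  apply: aeW => t n _; rewrite gee0_abs ?lee_fin ?sqr_ge0//.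
  by rewrite -real_normK ?num_real// -[leRHS]real_normK ?num_real// lerXn2r ?nnegrE.
have [_ _ cvg0] := dominated_convergence measurable_I01 mfh (measurable_cst _) fh0 if2 fhf.
rewrite integral0 in cvg0.
have e20 : 0 < e ^+ 2 by exact: exprn_gt0.
have [n /= hne] := filter_ex (cvgr_lt _ (fine_cvg cvg0) _ e20).
exists (h n); split => //; first by exists n%:R.
rewrite -ler_sqr ?nnegrE ?L2_norm1_ge0 ?(ltW e0)// sqr_L2_norm1.
exact: ltW.
Unshelve. all: by end_near.
Qed.

(** * Norm comparison and primitives of functions of mean zero *)

Lemma L2_norm1_cst {R : realType} {k : R} : 0 <= k -> L2_norm1 (fun=> k) = k.
Proof. by move=> k0; rewrite /L2_norm1 Rintegral_cst01 sqrtr_sqr ger0_norm. Qed.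

Lemma L2_norm1_le {R : realType} {f g : R -> R} (k : R) :
  L2_fun f -> L2_fun g -> 0 <= k -> (forall t, I t -> `|f t| <= k * `|g t|) ->
  L2_norm1 f <= k * L2_norm1 g.
Proof.
move=> Lf Lg k0 fg.
rewrite -ler_sqr ?nnegrE ?mulr_ge0 ?L2_norm1_ge0// exprMn -sqr_L2_norm1Z//.
rewrite !sqr_L2_norm1; apply: le_Rintegral => //.
- exact: Lf.2.
- exact: (L2_funZ k Lg).2.
- move=> t It; rewrite exprMn -real_normK ?num_real//.
  rewrite -(real_normK (num_real (g t))) -exprMn.
  by rewrite lerXn2r ?nnegrE ?mulr_ge0 ?fg.
Qed.

Lemma L2_norm1_le_cst {R : realType} {f : R -> R} (k : R) :
  L2_fun f -> 0 <= k -> (forall t, I t -> `|f t| <= k) -> L2_norm1 f <= k.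
Proof.
move=> Lf k0 fk; have := L2_norm1_le k Lf (L2_fun_cst 1) k0.
rewrite (L2_norm1_cst ler01) mulr1; apply => t It.
by rewrite normr1 mulr1 fk.
Qed.

(* [\1_`[0, t] - 1/2] has constant modulus, and as [g] has mean zero it can
   replace the indicator in the integral: this halves the trivial bound. *)
Lemma primitive_le {R : realType} (g : R -> R) (t : R) : L2_fun g ->
  \int[mu]_(s in I) g s = 0 -> I t ->
  `|\int[mu]_(s in `[0, t]) g s| <= 2^-1 * L2_norm1 g.
Proof.
move=> Lg g0; rewrite /I01/= in_itv/= => /andP[t0 t1].
pose k s : R := \1_(`[0, t]%classic : set R) s - 2^-1.
have mk : measurable_fun I k.
  apply: measurable_funB; last exact: measurable_cst.
  exact: measurable_indic.
have kE s : `|k s| = 2^-1.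
  by rewrite /k indicE; case: (s \in _) => /=; [rewrite ger0_norm|rewrite ler0_norm]; lra.
have Lk : L2_fun k by apply: (L2_fun_bounded 2^-1 mk) => s _; rewrite kE.
have kn : L2_norm1 k <= 2^-1.
  by apply: L2_norm1_le_cst => // s _; rewrite kE.
have -> : \int[mu]_(s in `[0, t]) g s = \int[mu]_(s in I) (k s * g s).
  rewrite (_ : `[0, t]%classic = I `&` `[0, t]%classic); last first.
    apply/seteqP; split=> [s|s []//]; rewrite /I01/= !in_itv/= => /andP[s0 st].
    by rewrite s0 st (le_trans st t1).
  rewrite Rintegral_mkcondr.
  have Lg2 := L2_funZ 2^-1 Lg.
  transitivity (\int[mu]_(s in I) (g \_ `[0, t]) s - 2^-1 * \int[mu]_(s in I) g s).
    by rewrite g0 mulr0 subr0.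
  rewrite -(RintegralZl _ measurable_I01 (L2_integrable Lg)).
  rewrite -RintegralB//.
  - by apply: eq_Rintegral => s _; rewrite patch_indic /k /=; ring.
  - rewrite patch_indic.
    apply: (L2_integrable (@L2_funM _ g _ 1 Lg _ _)).
      exact: measurable_indic.
    by move=> s _; rewrite indicE; case: (s \in _); rewrite ?normr1 ?normr0.
  - exact: L2_integrable Lg2.
apply: (le_trans (Cauchy_Schwarz01 Lk Lg)).
by rewrite ler_wpM2r// L2_norm1_ge0.
Qed.

Lemma measurable_primitive {R : realType} {g : R -> R} : integrable01 g ->
  measurable_fun I (fun t : R => \int[mu]_(s in `[0, t]) g s).
Proof.
move=> ig; apply: subspace_continuous_measurable_fun; first exact: measurable_I01.
exact: (parameterized_integral_continuous ler01 ig).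
Qed.

(** * The weighted pairing of a multiplier with a centered function *)

Lemma weighted_pairing_ge {R : realType} (lam a h : R -> R) (ca M : R) :
  L2_fun lam -> L2_fun h -> measurable_fun I a -> 0 <= ca ->
  (forall t, I t -> ca <= a t <= M) ->
  ca * L2_norm1 (centered h) ^+ 2
  - M * L2_norm1 (centered h) * L2_norm1 (fun t => lam t - h t)
  - `|\int[mu]_(t in I) lam t| * (2^-1 * (M - ca) * L2_norm1 (centered h))
  <= \int[mu]_(t in I) (lam t * (a t * centered h t)).
Proof.
move=> Ll Lh ma ca0 aM.
pose m := \int[mu]_(t in I) lam t; pose g := centered h.
(* The pieces satisfy [lam = g + k + m]. Subtracting the midpoint of [[ca, M]] from the weight makes
   [|b|] at most half the length of that interval. *)
pose k := centered (fun t => lam t - h t); pose b t := a t - 2^-1 * (M + ca).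
have caM : ca <= M.
  have /aM/andP[] : I (0 : R) by rewrite /I01/= in_itv/= lexx ler01.
  exact: le_trans.
have Lg : L2_fun g := L2_fun_centered Lh.
have Llh : L2_fun (fun t => lam t - h t) := L2_funB Ll Lh.
have Lk : L2_fun k := L2_fun_centered Llh.
have mb : measurable_fun I b by apply: measurable_funB => //; exact: measurable_cst.
have aM' t : I t -> `|a t| <= M.
  by move=> /aM/andP[? ?]; rewrite ger0_norm//; lra.
have bM t : I t -> `|b t| <= 2^-1 * (M - ca).
  by move=> /aM/andP[? ?]; rewrite /b ler_norml; apply/andP; split; lra.
have Lb : L2_fun b := L2_fun_bounded _ mb bM.
have Lag : L2_fun (fun t => g t * a t) := L2_funM _ Lg ma aM'.
have i1 : integrable01 (fun t => g t * a t * g t) := integrable01M Lag Lg.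
have i2 : integrable01 (fun t => g t * a t * k t) := integrable01M Lag Lk.
have i3 : integrable01 (fun t => b t * g t) := integrable01M Lb Lg.
have i3m : integrable01 (fun t => m * (b t * g t)) := integrableZl measurable_I01 m i3.
have i4 : integrable01 (fun t => m * (2^-1 * (M + ca)) * g t).
  exact: (L2_integrable (L2_funZ _ Lg)).
have i12 : integrable01 (fun t => g t * a t * g t + g t * a t * k t).
  exact: (integrableD measurable_I01 i1 i2).
have i34 : integrable01 (fun t => m * (b t * g t) + m * (2^-1 * (M + ca)) * g t).
  exact: (integrableD measurable_I01 i3m i4).
have -> : \int[mu]_(t in I) (lam t * (a t * centered h t)) =
    \int[mu]_(t in I) (g t * a t * g t) + \int[mu]_(t in I) (g t * a t * k t)
    + m * \int[mu]_(t in I) (b t * g t).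
  (* The added zero is the midpoint times [m] times the integral of [g]; it turns the weight [b]
     back into [a]. *)
  rewrite -[RHS]addr0 -(mulr0 (m * (2^-1 * (M + ca)))) -(Rintegral_centered Lh).
  rewrite -(RintegralZl _ measurable_I01 (L2_integrable Lg)).
  rewrite -(RintegralZl _ measurable_I01 i3) -addrA.
  rewrite -(RintegralD measurable_I01 i3m i4) -(RintegralD measurable_I01 i1 i2).
  rewrite -(RintegralD measurable_I01 i12 i34); apply: eq_Rintegral => t _.
  rewrite /k /g /b /centered.
  rewrite (RintegralB measurable_I01 (L2_integrable Ll) (L2_integrable Lh)) -/m.
  ring.
have h1 : ca * L2_norm1 g ^+ 2 <= \int[mu]_(t in I) (g t * a t * g t).
  rewrite sqr_L2_norm1 -(RintegralZl _ measurable_I01 Lg.2).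
  apply: le_Rintegral => //; first exact: (integrableZl measurable_I01 _ Lg.2).
  move=> t /aM/andP[? ?]; have := sqr_ge0 (g t); nra.
have h2 : `|\int[mu]_(t in I) (g t * a t * k t)|
    <= M * L2_norm1 g * L2_norm1 (fun t => lam t - h t).
  apply: (le_trans (Cauchy_Schwarz01 Lag Lk)); apply: ler_pM.
  - exact: L2_norm1_ge0.
  - exact: L2_norm1_ge0.
  - apply: L2_norm1_le => //; first exact: le_trans caM.
    by move=> t It; rewrite normrM mulrC ler_wpM2r// aM'.
  - exact: L2_norm1_centered_le.
have h3 : `|\int[mu]_(t in I) (b t * g t)| <= 2^-1 * (M - ca) * L2_norm1 g.
  apply: (le_trans (Cauchy_Schwarz01 Lb Lg)); rewrite ler_wpM2r ?L2_norm1_ge0//.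
  apply: L2_norm1_le_cst => //; lra.
have h4 : - (`|m| * (2^-1 * (M - ca) * L2_norm1 g)) <= m * \int[mu]_(t in I) (b t * g t).
  rewrite lerNl -mulrN; apply: le_trans (ler_norm _) _.
  by rewrite normrM normrN ler_wpM2l.
move: h1 h2 h4; rewrite ler_norml => h1 /andP[h2 _] h4.
rewrite -/g -/m; lra.
Qed.

(** * Euclidean geometry of the plane *)

Lemma dotxx_ge0 {R : realType} (p : R * R) : 0 <= dot p p.
Proof. by rewrite /dot -!expr2 addr_ge0// sqr_ge0. Qed.

Lemma enorm_ge0 {R : realType} (p : R * R) : 0 <= enorm p.
Proof. exact: sqrtr_ge0. Qed.

Lemma sqr_enorm {R : realType} (p : R * R) : enorm p ^+ 2 = dot p p.
Proof. by rewrite sqr_sqrtr// dotxx_ge0. Qed.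

Lemma enormZ {R : realType} (k : R) (u : R * R) : enorm u = 1 ->
  enorm (u.1 * k, u.2 * k) ^+ 2 = k ^+ 2.
Proof.
move=> u1; rewrite sqr_enorm -[RHS]mul1r -[in RHS](expr1n _ 2) -u1 sqr_enorm.
rewrite /dot/=; ring.
Qed.

Lemma ler_norm_dot {R : realType} (p q : R * R) : `|dot p q| <= enorm p * enorm q.
Proof.
rewrite -ler_sqr ?nnegrE ?mulr_ge0 ?enorm_ge0//.
rewrite real_normK ?num_real// exprMn !sqr_enorm /dot.
have := sqr_ge0 (p.1 * q.2 - p.2 * q.1); nra.
Qed.

Lemma enorm_vsub {R : realType} (p q : R * R) :
  enorm (vsub p q) <= enorm p + enorm q.
Proof.
rewrite -ler_sqr ?nnegrE ?addr_ge0 ?enorm_ge0// sqrrD !sqr_enorm.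
have := ler_norm_dot p q; rewrite ler_norml => /andP[pq _].
move: pq; rewrite mulr2n /dot /vsub/=; nra.
Qed.

(** * Almost-everywhere statements and the essential supremum *)

Lemma ae_lebesgueS {R : realType} (P Q : R -> Prop) : (forall t, P t -> Q t) ->
  {ae (@lebesgue_measure R), forall t, P t} ->
  {ae (@lebesgue_measure R), forall t, Q t}.
Proof. by move=> PQ; apply: (@filterS _ _ (ae_filter_ringOfSetsType _)). Qed.

Lemma ae_lebesgueS2 {R : realType} (P Q S : R -> Prop) :
  (forall t, P t -> Q t -> S t) ->
  {ae (@lebesgue_measure R), forall t, P t} ->
  {ae (@lebesgue_measure R), forall t, Q t} ->
  {ae (@lebesgue_measure R), forall t, S t}.
Proof. by move=> PQ; apply: (@filterS2 _ _ (ae_filter_ringOfSetsType _)). Qed.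

Lemma Linf_norm_ge0 {R : realType} (g : R -> R * R) : 0 <= Linf_norm g.
Proof.
rewrite /Linf_norm; set S := [set M | _].
(* The infimum of the empty set is [0] by convention. *)
have [->|/set0P S0] := eqVneq S set0; first by rewrite inf0.
by apply: lb_le_inf => // x [].
Qed.

(** The infimum is attained: each [inf S + 1/(n+1)] is an essential bound, and countably many null
    sets have a null union. *)
Lemma Linf_norm_ae {R : realType} (g : R -> R * R) : Linf_fun g ->
  {ae mu, forall t, I t -> enorm (g t) <= Linf_norm g}.
Proof.
move=> [_ [_ [M gM]]]; rewrite /Linf_norm; set S := [set M | _].
have S0 : S !=set0.
  exists `|M|; split=> //; apply: ae_lebesgueS gM => t gM It.
  by rewrite (le_trans (gM It))// ler_norm.
have hS : has_inf S by split=> //; exists 0 => x [].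
suff : {ae mu, forall t, forall n : nat, I t -> enorm (g t) <= inf S + n.+1%:R^-1}.
  apply: ae_lebesgueS => t gt It; apply/ler_addgt0Pr => e e0.
  have [n ne] := ltr_add_invr e0; rewrite add0r in ne.
  by rewrite (le_trans (gt n It))// lerD2l ltW.
apply: ae_foralln => n.
have n0 : (0 : R) < n.+1%:R^-1 by rewrite invr_gt0.
have [x [x0 gx] xS] := inf_adherent n0 hS.
by apply: ae_lebesgueS gx => t gx It; rewrite (le_trans (gx It))// ltW.
Qed.

Lemma Linf_fun_vsub {R : realType} (f g : R -> R * R) :
  Linf_fun f -> Linf_fun g -> Linf_fun (fun t => vsub (f t) (g t)).
Proof.
move=> [mf1 [mf2 [M fM]]] [mg1 [mg2 [N gN]]]; split; last split.
- exact: (measurable_funB mf1 mg1).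
- exact: (measurable_funB mf2 mg2).
- exists (M + N); apply: ae_lebesgueS2 fM gN => t fM gN It.
  by rewrite (le_trans (enorm_vsub _ _))// lerD ?fM ?gN.
Qed.

(** The unit interval has measure 1, so no null set covers it. A witness turns two-sided bounds
    holding almost everywhere into an inequality between their constants. *)
Lemma ae_I01_ex {R : realType} (P : R -> Prop) :
  {ae (@lebesgue_measure R), forall t, I t -> P t} -> exists2 t, I t & P t.
Proof.
move=> [N [mN N0 PN]]; apply: contrapT => nP.
have IN : I `<=` N.
  by move=> t It; apply: PN => /= /(_ It) Pt; apply: nP; exists t.
have I0 : mu (@I01 R) = 0%E := subset_measure0 measurable_I01 mN IN N0.
by have /eqP := etrans (esym I0) lebesgue_measure_I01; rewrite eqe eq_sym oner_eq0.
Qed.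

(** * Variations of the path in the fixed direction [u] *)

Section directional_variation.
Context {R : realType} (u : R * R) (h : R -> R) (K : R).
Hypotheses (u1 : enorm u = 1) (mh : measurable_fun I h)
  (hK : forall t, `|h t| <= K).

Let g := centered h.
Definition dir_variation_deriv (t : R) : R * R := (u.1 * g t, u.2 * g t).
Definition dir_variation (t : R) : R * R :=
  (\int[mu]_(s in `[0, t]) (dir_variation_deriv s).1,
   \int[mu]_(s in `[0, t]) (dir_variation_deriv s).2).

Let Lh : L2_fun h. Proof. by apply: (L2_fun_bounded K mh) => t _. Qed.

Let Lg : L2_fun g. Proof. exact: L2_fun_centered. Qed.

Let g0 : \int[mu]_(t in I) g t = 0. Proof. exact: Rintegral_centered. Qed.

(** Mean zero of [g] makes the primitive vanish at [1]; boundedness of [h] makes the derivative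
    essentially bounded. *)
Lemma indX_dir_variation : indX dir_variation dir_variation_deriv.
Proof.
have dir_variation0 : dir_variation 0 = (0, 0) by rewrite /dir_variation set_itv1 !Rintegral_set1.
split; last split=> //.
- split; last by move=> t _; rewrite dir_variation0/= !add0r.
  split; last split.
  + exact: (L2_funZ u.1 Lg).1.
  + exact: (L2_funZ u.2 Lg).1.
  + exists (K + `|\int[mu]_(s in I) h s|); apply: aeW => t _.
    rewrite -[enorm _]ger0_norm ?enorm_ge0// -sqrtr_sqr enormZ// sqrtr_sqr.
    by rewrite (le_trans (ler_normB _ _))// lerD2r.
- rewrite /dir_variation/= !(RintegralZl _ measurable_I01 (L2_integrable Lg)).
  by rewrite g0 !mulr0.
Qed.

Lemma L2_norm_dir_variation_deriv : L2_norm dir_variation_deriv = L2_norm1 g.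
Proof.
by rewrite /L2_norm /L2_norm1; congr Num.sqrt; apply: eq_Rintegral => t _; rewrite enormZ.
Qed.

(** Since [u] is a unit vector, the variation has the modulus of the primitive of [g], and on an
    interval of length 1 a uniform bound is an L2 bound. *)
Lemma L2_norm_dir_variation_le : L2_norm dir_variation <= 2^-1 * L2_norm1 g.
Proof.
pose F t := \int[mu]_(s in `[0, t]) g s.
have FM t : I t -> `|F t| <= 2^-1 * L2_norm1 g by exact: primitive_le.
have LF : L2_fun F.
  by apply: (L2_fun_bounded _ _ FM); exact: measurable_primitive (L2_integrable Lg).
have G0 : 0 <= 2^-1 * L2_norm1 g by rewrite mulr_ge0 ?L2_norm1_ge0.
suff -> : L2_norm dir_variation = L2_norm1 F by exact: L2_norm1_le_cst.
rewrite /L2_norm /L2_norm1; congr Num.sqrt; apply: eq_Rintegral => t.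
rewrite inE /I01/= in_itv/= => /andP[t0 t1].
have ig : mu.-integrable `[0, t] (EFin \o g).
  apply: (integrableS measurable_I01) (L2_integrable Lg) => //.
  move=> s; rewrite /I01/= !in_itv/= => /andP[-> st] /=.
  exact: le_trans st t1.
by rewrite /dir_variation/= !RintegralZl// enormZ.
Qed.

End directional_variation.

(** * Lower bounds for the supremum over variations *)

Lemma le_sup_dz {R : realType} (L : R) (dxi : R -> R * R) (lam : R -> R)
    (r dL : R) (delxi ddelxi : R -> R * R) :
  indX delxi ddelxi -> Z2_norm dL delxi ddelxi != 0 ->
  r <= infsup_ratio L dxi lam dL delxi ddelxi -> (r%:E <= sup_dz L dxi lam)%E.
Proof.
move=> iX Z0 rle; apply: (@le_trans _ _ (infsup_ratio L dxi lam dL delxi ddelxi)%:E).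
  by rewrite lee_fin.
by apply: ereal_sup_ubound; exists dL, delxi, ddelxi.
Qed.

Lemma sup_dz_ge_length {R : realType} (L : R) (dxi : R -> R * R) (lam : R -> R) :
  L2_fun lam ->
  ((2 * `|L| * `|\int[mu]_(t in I) lam t| / L2_norm1 lam)%:E <= sup_dz L dxi lam)%E.
Proof.
move=> Ll; set m := \int[mu]_(t in I) lam t.
(* The sign makes [- (2 * L * dL) * m] equal to [2 * |L| * |m|]. *)
pose dL : R := if 0 <= L * m then -1 else 1.
pose z (_ : R) : R * R := (0, 0).
have z0 : L2_norm z = 0.
  by rewrite /L2_norm /enorm /dot/= mulr0 addr0 sqrtr0 expr0n Rintegral_cst01 sqrtr0.
have Z1 : Z2_norm dL z z = 1.
  by rewrite /Z2_norm z0 !addr0 /dL; case: ifP; rewrite ?normrN normr1.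
apply: (@le_sup_dz _ _ _ _ _ dL z z).
- split=> //; split; last by move=> t _ /=; rewrite !Rintegral_cst// !mul0r !addr0.
  split; [exact: measurable_cst|split; first exact: measurable_cst].
  exists 0; apply: aeW => t _.
  by rewrite /enorm /dot/= mulr0 addr0 sqrtr0.
- by rewrite Z1 oner_neq0.
- rewrite /infsup_ratio Z1 mulr1 ler_wpM2r ?invr_ge0 ?L2_norm1_ge0//.
  have -> : \int[mu]_(t in I) (lam t * (2 * dot (dxi t) (z t) - 2 * L * dL)) =
      \int[mu]_(t in I) (lam t * - (2 * L * dL)).
    by apply: eq_Rintegral => t _; rewrite /dot/=; ring.
  rewrite (RintegralZr _ measurable_I01 (L2_integrable Ll)) -/m.
  rewrite -mulrA -normrM /dL; case: ifPn => [Lm|]; first by rewrite ger0_norm//; lra.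
  by rewrite -ltNge => Lm; rewrite ltr0_norm//; lra.
Qed.

(** The factor [3 / 2] bounds the [Z2_norm] of the variation: 1 for its derivative and 1/2 for the
    variation itself. *)
Lemma sup_dz_ge_direction {R : realType} (L : R) (u : R * R)
    (dxi : R -> R * R) (lam h : R -> R) (ca M K r : R) :
  enorm u = 1 -> L2_fun lam -> 0 < L2_norm1 lam -> Linf_fun dxi ->
  {ae mu, forall t, I t -> ca <= dot u (dxi t) <= M} ->
  measurable_fun I h -> (forall t, `|h t| <= K) ->
  0 < L2_norm1 (centered h) -> 0 <= r ->
  r * (L2_norm1 lam * (3 / 2 * L2_norm1 (centered h))) <=
    2 * \int[mu]_(t in I) (lam t * (clamp ca M (dot u (dxi t)) * centered h t)) ->
  (r%:E <= sup_dz L dxi lam)%E.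
Proof.
move=> u1 Ll N0 [md1 [md2 _]] aM mh hK G0 r0 rle.
have Lh : L2_fun h by apply: (L2_fun_bounded K) => // t _.
have Lg := L2_fun_centered Lh.
have ma : measurable_fun I (fun t => dot u (dxi t)).
  by apply: measurable_funD; apply: measurable_funM => //; exact: measurable_cst.
have mc := measurable_clamp ca M _ ma.
have Zle : Z2_norm 0 (dir_variation u h) (dir_variation_deriv u h) <= 3 / 2 * L2_norm1 (centered h).
  rewrite /Z2_norm normr0 add0r L2_norm_dir_variation_deriv//.
  have := L2_norm_dir_variation_le u h K u1 mh hK; lra.
have Z0 : 0 < Z2_norm 0 (dir_variation u h) (dir_variation_deriv u h).
  by rewrite /Z2_norm normr0 add0r L2_norm_dir_variation_deriv// ltr_wpDl// sqrtr_ge0.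
apply: (@le_sup_dz _ _ _ _ _ 0 (dir_variation u h) (dir_variation_deriv u h)).
- exact: indX_dir_variation hK.
- by rewrite gt_eqF.
- rewrite /infsup_ratio ler_pdivlMr ?mulr_gt0//.
  suff -> : \int[mu]_(t in I) (lam t * (2 * dot (dxi t) (dir_variation_deriv u h t) - 2 * L * 0)) =
      2 * \int[mu]_(t in I) (lam t * (clamp ca M (dot u (dxi t)) * centered h t)).
    by apply: le_trans rle; rewrite ler_wpM2l// ler_wpM2l// ltW.
  have caM : ca <= M.
    by have [s _ /andP[]] := ae_I01_ex _ aM; exact: le_trans.
  have clampM t : I t -> `|clamp ca M (dot u (dxi t))| <= `|ca| + `|M|.
    move=> _; have /andP[ca_le le_M] := clamp_itv ca M (dot u (dxi t)) caM.
    rewrite ler_norml; have := ler_norm (- ca); have := ler_norm M.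
    have := normr_ge0 ca; have := normr_ge0 M; rewrite normrN; lra.
  have Lc := L2_funM _ Lg mc clampM.
  have ic : integrable01 (fun t => lam t * (clamp ca M (dot u (dxi t)) * centered h t)).
    have := integrable01M Ll Lc; apply: eq_integrable => // t _ /=.
    by congr EFin; rewrite (mulrC (centered h t)).
  rewrite -(RintegralZl _ measurable_I01 ic).
  have mr : measurable_fun I (fun t => 2 * dot (dxi t) (dir_variation_deriv u h t) - 2 * L * 0).
    apply: measurable_funB; last exact: measurable_cst.
    apply: measurable_funM; first exact: measurable_cst.
    by apply: measurable_funD; apply: measurable_funM => //;
      apply: measurable_funM; [exact: measurable_cst|exact: Lg.1|
        exact: measurable_cst|exact: Lg.1].
  congr fine; apply: ae_eq_integral => //.
  + by apply/measurable_EFinP; apply: measurable_funM => //; exact: Ll.1.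
  + exact: (measurable_int _ (integrableZl measurable_I01 2 ic)).
  (* Clamping changes the weight on a null set only. *)
  + apply: ae_lebesgueS aM => t aM It; rewrite clamp_id ?aM//.
    by congr EFin; rewrite /dot /dir_variation_deriv/=; ring.
Qed.

(** To be read with [gam = c - Rr] and [l = |Ls|]. The lower bound on [|L|] serves twice: it gives
    [gam <= |L|], and it bounds half the length of the range of the weight by [|L|]. *)
Lemma sup_dz_ge {R : realType} (L l r1 c gam s : R) (u : R * R)
    (dxi : R -> R * R) (lam : R -> R) :
  0 <= r1 -> c <= l -> 0 < gam -> gam <= c - r1 -> gam + l - (c - r1) <= `|L| ->
  0 < s -> s <= 13 / 20 -> enorm u = 1 -> Linf_fun dxi ->
  {ae mu, forall t, I t -> c - r1 <= dot u (dxi t) <= l + r1} ->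
  L2_fun lam -> 0 < L2_norm1 lam ->
  ((gam * s)%:E <= sup_dz L dxi lam)%E.
Proof.
move=> r10 cl gam0; set ca := c - r1 => gamca gamL s0 s1 u1 Ldxi aM Ll N0.
set M := l + r1 in aM *; set N := L2_norm1 lam in N0 *.
pose m := \int[mu]_(t in I) lam t.
have [lem|ltm] := leP (gam * s) (2 * `|L| * `|m| / N).
  by apply: le_trans (sup_dz_ge_length L dxi lam Ll); rewrite lee_fin.
have {}ltm : 2 * `|L| * `|m| < gam * s * N by move: ltm; rewrite ltr_pdivrMr.
have ca0 : 0 < ca by exact: lt_le_trans gamca.
have cal : ca <= l by rewrite /ca; lra.
have caM : ca <= M by rewrite /ca /M; lra.
have Mca : 2^-1 * (M - ca) <= l - ca by rewrite /ca /M; lra.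
have M0 : 0 < M by exact: lt_le_trans caM.
have m0 := normr_ge0 m.
(* The tolerance is chosen so that both [M * E <= ca * N / 25] and, as [ca <= M], [E <= N / 25]. *)
have [h [mh [K hK] lamh]] : exists h : R -> R, [/\ measurable_fun I h,
    exists K, forall t, `|h t| <= K
    & L2_norm1 (fun t => lam t - h t) <= 25^-1 * (ca / M) * N].
  by apply: L2_truncation => //; rewrite !mulr_gt0 ?invr_gt0.
have Lh : L2_fun h by apply: (L2_fun_bounded K) => // t _.
have := weighted_pairing_ge lam (fun t => clamp ca M (dot u (dxi t))) h ca M Ll Lh.
have [md1 [md2 _]] := Ldxi.
have ma : measurable_fun I (fun t => dot u (dxi t)).
  by apply: measurable_funD; apply: measurable_funM => //; exact: measurable_cst.
move=> /(_ (measurable_clamp ca M _ ma) (ltW ca0)).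
move=> /(_ (fun t _ => clamp_itv _ _ _ caM)); rewrite -/m.
set X := \int[mu]_(t in I) _.
set G := L2_norm1 (centered h); set E := L2_norm1 (fun t => lam t - h t) in lamh *.
have E0 : 0 <= E := L2_norm1_ge0 _.
have ME : M * E <= 25^-1 * ca * N.
  have := ler_wpM2l (ltW M0) lamh; congr (_ <= _).
  field; exact: lt0r_neq0.
have EN : E <= 25^-1 * N.
  apply: (le_trans lamh); rewrite ler_wpM2r ?(ltW N0)//.
  by rewrite ler_piMr// ler_pdivrMr// mul1r.
have mN : `|m| <= 13 / 40 * N.
  have : gam * (2 * `|m|) <= gam * (13 / 20 * N).
    rewrite (mulrCA gam) mulrA.
    apply: (@le_trans _ _ (2 * `|L| * `|m|)).
      by rewrite ler_wpM2r// ler_wpM2l//; lra.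
    apply: (le_trans (ltW ltm)); rewrite -mulrA ler_wpM2l ?(ltW gam0)//.
    by rewrite ler_wpM2r// ltW.
  by rewrite ler_pM2l//; lra.
(* A small mean leaves most of the norm after centering: [1 - (13/40)^2 >= (9/10)^2]. *)
have C0 : 9 / 10 * N <= L2_norm1 (centered lam).
  rewrite -ler_sqr ?nnegrE ?L2_norm1_ge0//; last by rewrite mulr_ge0// ltW.
  rewrite sqr_L2_norm1_centered// -/N -/m -(real_normK (num_real m)).
  nra.
have CG : L2_norm1 (centered lam) <= G + E.
  have Llh := L2_funB Ll Lh.
  have -> : centered lam = (fun t => centered h t + centered (fun t => lam t - h t) t).
    apply/funext => t; rewrite /centered.
    rewrite (RintegralB measurable_I01 (L2_integrable Ll) (L2_integrable Lh)); ring.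
  apply: (le_trans (L2_norm1D (L2_fun_centered Lh) (L2_fun_centered Llh))).
  by rewrite lerD2l L2_norm1_centered_le.
have GN : 43 / 50 * N <= G by lra.
have G0 : 0 < G by apply: lt_le_trans GN; rewrite mulr_gt0.
have mMca : `|m| * (2^-1 * (M - ca)) <= 2^-1 * (gam * s * N).
  apply: (@le_trans _ _ (`|m| * `|L|)); last by lra.
  by rewrite ler_wpM2l//; lra.
move=> Xge.
apply: (sup_dz_ge_direction L u dxi lam h ca M K) => //; rewrite -/G -/N -/X.
  by rewrite mulr_ge0// ltW.
have sca : gam * s * N <= 13 / 20 * ca * N.
  by rewrite ler_wpM2r ?(ltW N0)// mulrC ler_pM// ltW.
have caG : ca * (43 / 50 * N) <= ca * G by rewrite ler_wpM2l// ltW.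
have caN : 0 < ca * N by rewrite mulr_gt0.
(* The mean term costs at most [gam * s * N], so it suffices that [5/2 * (gam * s * N) <= 2 * (43/50
   - 1/25) * (ca * N)]; this holds because [5/2 * 13/20 = 1.625] is below [1.64]. *)
have key : 3 / 2 * (gam * s * N) <= 2 * (ca * G - M * E - `|m| * (2^-1 * (M - ca))).
  lra.
have {key} := ler_wpM2r (ltW G0) key; move: Xge; lra.
Qed.

(** * The constant [kappa] and the inf-sup bound *)

(** The speed quotient is at least 1, so the radicand is at least [19/8], which just exceeds
    [(20/13)^2]. *)
Lemma kappa_factor_le {R : realType} (vbar c0bar x : R) :
  0 <= c0bar -> c0bar < vbar -> 0 <= x ->
  (Num.sqrt (3 / 8 + 2 * ((vbar + c0bar) / (vbar - c0bar) + x) ^+ 2))^-1 <= 13 / 20.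
Proof.
move=> c0 c0v x0.
have q1 : 1 <= (vbar + c0bar) / (vbar - c0bar).
  by rewrite ler_pdivlMr ?subr_gt0// mul1r; lra.
set q := _ + x; have {}q1 : 1 <= q by rewrite /q; lra.
have q2 : 1 <= q ^+ 2 by rewrite exprn_ege1.
have X0 : 0 < 3 / 8 + 2 * q ^+ 2 by lra.
rewrite invf_ple ?posrE ?sqrtr_gt0//.
by rewrite -ler_sqr ?nnegrE ?sqrtr_ge0// sqr_sqrtr ?(ltW X0)//; lra.
Qed.

Theorem theorem8 (R : realType) (vbar : R) (xO xD : R * R)
  (w : R * R -> R * R) (Om : set (R * R)) (c0bar : R)
  (Ls : R) (xis dxis : R -> R * R) (c : R) (u : R * R)
  (L : R) (xi dxi : R -> R * R) (Rr : R) :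
  0 < vbar -> xO != xD ->
  C3 w -> (forall x, enorm (w x) < vbar) ->
  ellipse_foci xO xD Om ->
  (forall L' xi' dxi', global_minP vbar w xO xD L' xi' dxi' ->
     forall t, 0 <= t <= 1 -> Om (xi' t)) ->
  c0bar < vbar -> (forall x, Om x -> enorm (w x) <= c0bar) ->
  global_minP vbar w xO xD Ls xis dxis ->
  0 < c -> enorm u = 1 ->
  {ae (@lebesgue_measure R), forall t, I01 t -> c <= dot u (dxis t)} ->
  inX xO xD xi dxi ->
  Zinf_dist L xi dxi Ls xis dxis <= Rr -> Rr < c ->
  ((kappa vbar c0bar c (enorm (vsub xD xO)) Rr)%:E <= infsup L dxi)%E /\
  0 < kappa vbar c0bar c (enorm (vsub xD xO)) Rr.
Proof.
move=> _ _ _ _ [a [foc_a OmE]] _ c0v Omw [[[[Ldxis _] _] dxisL] _] c0 u1 cdxis.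
move=> [[Ldxi _] _] ZR Rc.
(* The focus [xO] lies in the ellipse, so [c0bar] bounds a norm there. *)
have c0bar0 : 0 <= c0bar.
  apply: (le_trans (enorm_ge0 (w xO))); apply: Omw; rewrite OmE /=.
  have -> : enorm (vsub xO xO) = 0 by rewrite /enorm /dot /vsub/= !subrr mulr0 addr0 sqrtr0.
  have -> : enorm (vsub xO xD) = enorm (vsub xD xO).
    by rewrite /enorm; congr Num.sqrt; rewrite /dot /vsub/=; ring.
  by rewrite add0r ltW.
pose r1 := Linf_norm (fun t => vsub (dxi t) (dxis t)).
have r10 : 0 <= r1 := Linf_norm_ge0 _.
have LLs : `|L - Ls| + r1 <= Rr.
  have := Linf_norm_ge0 (fun t => vsub (xi t) (xis t)).
  by move: ZR; rewrite /Zinf_dist -/r1; lra.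
have Rr0 : 0 <= Rr by apply: le_trans LLs; rewrite addr_ge0.
(* The upper bound is Cauchy-Schwarz with the constant speed [|Ls|] of the minimizer. *)
have Lsl : {ae mu, forall t, I t -> c <= dot u (dxis t) <= `|Ls|}.
  apply: ae_lebesgueS2 cdxis dxisL => t cu dL It; rewrite cu//=.
  apply: (le_trans (ler_norm _)); apply: (le_trans (ler_norm_dot _ _)).
  by rewrite u1 mul1r /enorm dL// sqrtr_sqr.
have cLs : c <= `|Ls| by have [t _ /andP[]] := ae_I01_ex _ Lsl; exact: le_trans.
have dr1 := Linf_norm_ae _ (Linf_fun_vsub _ _ Ldxi Ldxis).
have aM : {ae mu, forall t, I t -> c - r1 <= dot u (dxi t) <= `|Ls| + r1}.
  apply: ae_lebesgueS2 Lsl dr1 => t cu dr It.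
  have /andP[cu1 cu2] := cu It.
  have : `|dot u (vsub (dxi t) (dxis t))| <= r1.
    by apply: (le_trans (ler_norm_dot _ _)); rewrite u1 mul1r dr.
  have -> : dot u (vsub (dxi t) (dxis t)) = dot u (dxi t) - dot u (dxis t).
    by rewrite /dot /vsub/=; ring.
  by rewrite ler_norml => /andP[? ?]; apply/andP; split; lra.
(* Together with [LLs] this yields [|Ls| - Rr + r1 <= |L|], the length condition of [sup_dz_ge]. *)
have LsL : `|Ls| - `|L - Ls| <= `|L|.
  by have := ler_normB L (L - Ls); rewrite subKr; lra.
set s := (Num.sqrt (3 / 8 + 2 * ((vbar + c0bar) / (vbar - c0bar) +
  Rr / enorm (vsub xD xO)) ^+ 2))^-1.
have s0 : 0 < s.
  by rewrite invr_gt0 sqrtr_gt0; set q := _ + _ / _; have := sqr_ge0 q; lra.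
have s1 : s <= 13 / 20.
  by apply: kappa_factor_le => //; rewrite divr_ge0// enorm_ge0.
rewrite /kappa -/s; split; last by rewrite mulr_gt0// subr_gt0.
apply: le_ereal_inf_tmp => _ [lam [Ll [lam0 ->]]].
apply: (sup_dz_ge L `|Ls| r1 c _ s u) => //.
- by rewrite subr_gt0.
- by have := normr_ge0 (L - Ls); lra.
- by lra.
- by rewrite lt_neqAle eq_sym lam0 L2_norm1_ge0.
Qed.
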